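(* Let $E,F$ be vector lattices with $F$ Dedekind complete, and let $A\subset\mathcal{U}_+(E,F)$ be an increasing (upwards directed) set, i.e. for all $S,T\in A$ there is $V\in A$ with $S\le V$ and $T\le V$. Then for every $T\in\mathcal{U}_+(E,F)$ and every $x\in E$, \[ (\pi_AT)(x)=\sup_{\varepsilon>0,\ S\in A}\ \inf_{y\in\mathcal{F}_x,\ \rho\in\mathfrak{P}(F)}\{\rho Ty+\rho^\perp Tx:\ \rho S(x-y)\le\varepsilon Sx\}, \] \[ (\pi_A^\perp T)(x)=\inf_{\varepsilon>0,\ S\in A}\ \sup_{y\in\mathcal{F}_x,\ \rho\in\mathfrak{P}(F)}\{\rho Ty:\ \rho Sy\le\varepsilon Sx\}. \]
   Context: For a vector lattice $E$, an element $z$ is a fragment of $x\in E$ if $|z|\wedge|x-z|=0$; $\mathcal{F}_x$ denotes the set of fragments of $x$. An operator $T\colon E\to F$ is orthogonally additive if $T(x+y)=Tx+Ty$ whenever $|x|\wedge|y|=0$. $\mathcal{U}(E,F)$ is the set of orthogonally additive, order bounded (in general nonlinear) operators $E\to F$, ordered by $S\le T$ iff $Tx-Sx\ge0$ for all $x$; $\mathcal{U}_+(E,F)$ is its positive cone; for Dedekind complete $F$ it is a Dedekind complete vector lattice. $\mathfrak{P}(F)$ is the Boolean algebra of band projections of $F$, and $\rho^\perp=I_F-\rho$. For $A\subset\mathcal{U}(E,F)$, $\pi_A$ denotes the band projection in $\mathcal{U}(E,F)$ onto the band $A^{\perp\perp}$ and $\pi_A^\perp=I-\pi_A$ the band projection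 onto $A^\perp$. Suprema and infima are taken in $F$. *)

(* Defs.v *)
From Stdlib Require Import Reals.
Open Scope R_scope.


Record VectorLattice := {
  vl_car :> Type;
  vl_zero : vl_car;
  vl_add : vl_car -> vl_car -> vl_car;
  vl_opp : vl_car -> vl_car;
  vl_scal : R -> vl_car -> vl_car;
  vl_le : vl_car -> vl_car -> Prop;
  vl_sup : vl_car -> vl_car -> vl_car;
  vl_inf : vl_car -> vl_car -> vl_car;
  vl_addA : forall x y z, vl_add x (vl_add y z) = vl_add (vl_add x y) z;
  vl_addC : forall x y, vl_add x y = vl_add y x;
  vl_add0 : forall x, vl_add vl_zero x = x;
  vl_addN : forall x, vl_add (vl_opp x) x = vl_zero;
  vl_scal1 : forall x, vl_scal 1 x = x;
  vl_scalA : forall a b x, vl_scal a (vl_scal b x) = vl_scal (a * b) x;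
  vl_scalDl : forall a b x, vl_scal (a + b) x = vl_add (vl_scal a x) (vl_scal b x);
  vl_scalDr : forall a x y, vl_scal a (vl_add x y) = vl_add (vl_scal a x) (vl_scal a y);
  vl_le_refl : forall x, vl_le x x;
  vl_le_trans : forall x y z, vl_le x y -> vl_le y z -> vl_le x z;
  vl_le_anti : forall x y, vl_le x y -> vl_le y x -> x = y;
  vl_le_add : forall x y z, vl_le x y -> vl_le (vl_add x z) (vl_add y z);
  vl_le_scal : forall a x y, 0 <= a -> vl_le x y -> vl_le (vl_scal a x) (vl_scal a y);
  vl_sup_ubl : forall x y, vl_le x (vl_sup x y);
  vl_sup_ubr : forall x y, vl_le y (vl_sup x y);
  vl_sup_least : forall x y z, vl_le x z -> vl_le y z -> vl_le (vl_sup x y) z;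
  vl_inf_lbl : forall x y, vl_le (vl_inf x y) x;
  vl_inf_lbr : forall x y, vl_le (vl_inf x y) y;
  vl_inf_greatest : forall x y z, vl_le z x -> vl_le z y -> vl_le z (vl_inf x y)
}.

Arguments vl_zero {v}.
Arguments vl_add {v}.
Arguments vl_opp {v}.
Arguments vl_scal {v}.
Arguments vl_le {v}.
Arguments vl_sup {v}.
Arguments vl_inf {v}.

Section VL.
Variable E : VectorLattice.

Definition vl_sub (x y : E) : E := vl_add x (vl_opp y).
Definition vl_abs (x : E) : E := vl_sup x (vl_opp x).
Definition vl_disj (x y : E) : Prop := vl_inf (vl_abs x) (vl_abs y) = vl_zero.
Definition fragment (x z : E) : Prop := vl_disj z (vl_sub x z).

Definition is_ub (D : E -> Prop) (b : E) : Prop := forall d, D d -> vl_le d b.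
Definition is_lb (D : E -> Prop) (b : E) : Prop := forall d, D d -> vl_le b d.
Definition is_sup (D : E -> Prop) (s : E) : Prop :=
  is_ub D s /\ forall b, is_ub D b -> vl_le s b.
Definition is_inf (D : E -> Prop) (s : E) : Prop :=
  is_lb D s /\ forall b, is_lb D b -> vl_le b s.

Definition dedekind_complete : Prop :=
  forall D : E -> Prop, (exists d, D d) -> (exists b, is_ub D b) ->
    exists s, is_sup D s.

Definition order_bounded_set (D : E -> Prop) : Prop :=
  exists a b, forall d, D d -> vl_le a d /\ vl_le d b.

Definition is_band (B : E -> Prop) : Prop :=
  B vl_zero /\
  (forall x y, B x -> B y -> B (vl_add x y)) /\
  (forall a x, B x -> B (vl_scal a x)) /\
  (forall x y, vl_le (vl_abs x) (vl_abs y) -> B y -> B x) /\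
  (forall D s, (forall d, D d -> B d) -> is_sup D s -> B s).

Definition band_proj (rho : E -> E) : Prop :=
  exists B, is_band B /\
    forall x, B (rho x) /\ (forall b, B b -> vl_disj (vl_sub x (rho x)) b).
End VL.
Arguments vl_sub {E}.
Arguments vl_abs {E}.
Arguments vl_disj {E}.
Arguments fragment {E}.
Arguments is_ub {E}.
Arguments is_lb {E}.
Arguments is_sup {E}.
Arguments is_inf {E}.
Arguments order_bounded_set {E}.
Arguments is_band {E}.
Arguments band_proj {E}.

Section OA.
Variables E F : VectorLattice.

Definition orth_additive (T : E -> F) : Prop :=
  forall x y : E, vl_disj x y -> T (vl_add x y) = vl_add (T x) (T y).

Definition order_bounded_op (T : E -> F) : Prop :=
  forall D : E -> Prop, order_bounded_set D ->
    order_bounded_set (fun z : F => exists d, D d /\ z = T d).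

Definition inU (T : E -> F) : Prop := orth_additive T /\ order_bounded_op T.
Definition inUp (T : E -> F) : Prop := inU T /\ forall x, vl_le vl_zero (T x).

Definition op_le (S T : E -> F) : Prop := forall x, vl_le vl_zero (vl_sub (T x) (S x)).
Definition op_opp (S : E -> F) : E -> F := fun x => vl_opp (S x).
Definition op_sub (S T : E -> F) : E -> F := fun x => vl_sub (S x) (T x).
Definition op_zero : E -> F := fun _ => vl_zero.

Definition is_sup_U (S R W : E -> F) : Prop :=
  inU W /\ op_le S W /\ op_le R W /\
  forall V, inU V -> op_le S V -> op_le R V -> op_le W V.
Definition is_inf_U (S R W : E -> F) : Prop :=
  inU W /\ op_le W S /\ op_le W R /\
  forall V, inU V -> op_le V S -> op_le V R -> op_le V W.
Definition is_abs_U (S W : E -> F) : Prop := is_sup_U S (op_opp S) W.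
Definition disj_U (S R : E -> F) : Prop :=
  exists a b, is_abs_U S a /\ is_abs_U R b /\ is_inf_U a b op_zero.

Definition perp_U (A : (E -> F) -> Prop) (S : E -> F) : Prop :=
  inU S /\ forall R, A R -> disj_U S R.
Definition perpperp_U (A : (E -> F) -> Prop) (S : E -> F) : Prop :=
  inU S /\ forall R, perp_U A R -> disj_U S R.

(** P = pi_A T : the band projection of T onto A^perpperp, i.e. the component
    of T in the decomposition U(E,F) = A^perpperp (+) A^perp. *)
Definition is_piA (A : (E -> F) -> Prop) (T P : E -> F) : Prop :=
  inU P /\ perpperp_U A P /\ perp_U A (op_sub T P).

Definition increasing_set (A : (E -> F) -> Prop) : Prop :=
  (exists S, A S) /\
  forall S T, A S -> A T -> exists V, A V /\ op_le S V /\ op_le T V.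
End OA.
Arguments orth_additive {E F}.
Arguments order_bounded_op {E F}.
Arguments inU {E F}.
Arguments inUp {E F}.
Arguments op_le {E F}.
Arguments op_opp {E F}.
Arguments op_sub {E F}.
Arguments op_zero {E F}.
Arguments is_sup_U {E F}.
Arguments is_inf_U {E F}.
Arguments is_abs_U {E F}.
Arguments disj_U {E F}.
Arguments perp_U {E F}.
Arguments perpperp_U {E F}.
Arguments is_piA {E F}.
Arguments increasing_set {E F}.

(* Main.v *)
Require Import Defs.
From Stdlib Require Import Reals Lra List IndefiniteDescription Classical.
Open Scope R_scope.

(* Write [Q := T - P]; both [P] and [Q] are positive. Since [y |-> x - y] permutes
   the fragments of [x], the first formula is [T x] minus the second one, so only
   [Q x] is computed.

   [Q x <= sup]: for [S] in [A] the meet of [S] and [Q] in U(E,F), given by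
   [inf_y (S y + Q (x - y))], vanishes. For a fragment [y] let [rho] project onto
   the disjoint complement of [(S y - eps S x)^+]; the pair [(y, rho)] is
   admissible, and the excess [v] of [Q x] over the supremum satisfies
   [v /\ eps S x <= S y + Q (x - y)], so [v] is disjoint from [eps S x]. Projecting
   onto the disjoint complement of [eps S x] with [y = x] then gives [v = 0].

   [inf <= Q x]: [P] is the supremum of the directed family of those [0 <= W <= P]
   with [W <= t S] for some [t >= 0] and [S] in [A]. If [rho (S y) <= eps S x] then
   [rho (T y) <= Q x + (P - W) x + t eps S x]; let [eps] tend to [0], then [W] to
   [P]. *)

Declare Scope vl_scope.
Delimit Scope vl_scope with V.
Notation "0" := vl_zero : vl_scope.
Notation "x + y" := (vl_add x y) : vl_scope.
Notation "- x" := (vl_opp x) : vl_scope.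
Notation "x - y" := (vl_sub x y) : vl_scope.
Notation "a *: x" := (vl_scal a x) (at level 40, left associativity) : vl_scope.
Notation "x <= y" := (vl_le x y) : vl_scope.
Notation "x ⊔ y" := (vl_sup x y) (at level 45, left associativity) : vl_scope.
Notation "x ⊓ y" := (vl_inf x y) (at level 45, left associativity) : vl_scope.
Notation "x ⟂ y" := (vl_disj x y) (at level 70, no associativity) : vl_scope.

(** * Linear identities by reflection *)

Inductive vexpr :=
| VVar (n : nat)
| VZero
| VAdd (e f : vexpr)
| VOpp (e : vexpr)
| VScal (a : R) (e : vexpr).

Fixpoint vcoef (e : vexpr) (n : nat) : R :=
  match e with
  | VVar m => if Nat.eqb m n then 1 else 0
  | VZero => 0
  | VAdd e f => vcoef e n + vcoef f n
  | VOpp e => - vcoef e n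
  | VScal a e => a * vcoef e n
  end.

(** Recursive, so that [cbn] turns it into a finite conjunction of equations between real
    coefficients. *)
Fixpoint all_below (n : nat) (Q : nat -> Prop) : Prop :=
  match n with
  | O => True
  | S m => Q O /\ all_below m (fun k => Q (S k))
  end.

Section Reflection.
Context {V : VectorLattice}.
Implicit Types x y z : V.
Local Open Scope vl_scope.

Lemma addr0 x : x + 0 = x.
Proof. now rewrite vl_addC, vl_add0. Qed.

Lemma addrN x : x + - x = 0.
Proof. now rewrite vl_addC, vl_addN. Qed.

Lemma addIr z x y : x + z = y + z -> x = y.
Proof.
intros H.
now rewrite <- (addr0 x), <- (addrN z), vl_addA, H, <- vl_addA, addrN, addr0.
Qed.

Lemma scal0 x : 0%R *: x = 0.
Proof.
apply (addIr (0%R *: x)).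
now rewrite <- (vl_scalDl _ 0 0), Rplus_0_r, vl_add0.
Qed.

Lemma scalr0 a : a *: (0 : V) = 0.
Proof. now rewrite <- (scal0 0), vl_scalA, Rmult_0_r. Qed.

Lemma scalN1 x : (-1) *: x = - x.
Proof.
apply (addIr x). rewrite vl_addN. transitivity ((-1) *: x + 1 *: x); [now rewrite vl_scal1|].
rewrite <- vl_scalDl. replace (-1 + 1)%R with 0%R by ring. apply scal0.
Qed.

Lemma addrCA x y z t : (x + y) + (z + t) = (x + z) + (y + t).
Proof.
rewrite <- !vl_addA. f_equal. rewrite !vl_addA. f_equal. apply vl_addC.
Qed.

Fixpoint veval (env : list V) (e : vexpr) : V :=
  match e with
  | VVar n => nth n env 0
  | VZero => 0
  | VAdd e f => veval env e + veval env f
  | VOpp e => - veval env e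
  | VScal a e => a *: veval env e
  end.

Fixpoint lincomb (c : nat -> R) (env : list V) : V :=
  match env with
  | nil => 0
  | v :: l => c O *: v + lincomb (fun n => c (S n)) l
  end.

Lemma lincomb0 env : lincomb (fun _ => 0%R) env = 0.
Proof. induction env; simpl; [easy|]. now rewrite IHenv, scal0, addr0. Qed.

Lemma lincombD c d env :
  lincomb (fun n => (c n + d n)%R) env = lincomb c env + lincomb d env.
Proof.
revert c d; induction env as [|v l IH]; intros c d; simpl; [now rewrite addr0|].
now rewrite (IH (fun n => c (S n))), vl_scalDl, addrCA.
Qed.

Lemma lincombZ a c env : lincomb (fun n => (a * c n)%R) env = a *: lincomb c env.
Proof.
revert c; induction env as [|v l IH]; intros c; simpl; [now rewrite scalr0|].
now rewrite (IH (fun n => c (S n))), vl_scalDr, vl_scalA.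
Qed.

Lemma lincomb_ext c d env :
  all_below (length env) (fun n => c n = d n) -> lincomb c env = lincomb d env.
Proof.
revert c d; induction env as [|v l IH]; intros c d; simpl; [easy|].
intros [H0 H]. now rewrite H0, (IH _ _ H).
Qed.

Lemma lincomb_var m env :
  lincomb (fun n => if Nat.eqb m n then 1%R else 0%R) env = nth m env 0.
Proof.
revert m; induction env as [|v l IH]; intros [|m]; simpl; try easy.
- rewrite lincomb0, addr0. apply vl_scal1.
- now rewrite IH, scal0, vl_add0.
Qed.

Lemma veval_coef env e : veval env e = lincomb (vcoef e) env.
Proof.
induction e as [m| |e IHe f IHf|e IH|a e IH]; simpl.
- now rewrite <- lincomb_var.
- now rewrite <- (lincomb0 env).
- now rewrite lincombD, IHe, IHf.
- rewrite IH, <- scalN1, <- lincombZ. apply lincomb_ext.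
  generalize (vcoef e); induction (length env) as [|k IHk]; intros c; simpl; [easy|].
  split; [ring|]. apply (IHk (fun n => c (S n))).
- now rewrite lincombZ, IH.
Qed.

Lemma veval_eq env e f :
  all_below (length env) (fun n => vcoef e n = vcoef f n) -> veval env e = veval env f.
Proof. intros H. rewrite !veval_coef. now apply lincomb_ext. Qed.

End Reflection.

(** * Tactics reifying linear expressions *)

Ltac vl_find a l :=
  lazymatch l with
  | nil => constr:(false)
  | cons ?b ?l' => match constr:(Set) with
                   (* Running [constr_eq] inside a [match] on [constr:(Set)] lets it act while a
                      term is computed; its failure selects the next branch. *)
                   | _ => let _ := match constr:(Set) with _ => constr_eq a b end in constr:(true)
                   | _ => vl_find a l'
                   end
  end.

Ltac vl_atoms t l :=
  lazymatch t with
  | vl_add ?x ?y => let l := vl_atoms x l in vl_atoms y l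
  | vl_sub ?x ?y => let l := vl_atoms x l in vl_atoms y l
  | vl_opp ?x => vl_atoms x l
  | vl_scal _ ?x => vl_atoms x l
  | vl_zero => l
  | _ => lazymatch vl_find t l with
         | true => l
         | false => constr:(cons t l)
         end
  end.

Ltac vl_index a l :=
  match l with
  | cons ?b ?l' => let _ := match constr:(Set) with _ => constr_eq a b end in constr:(O)
  | cons _ ?l' => let n := vl_index a l' in constr:(S n)
  end.

Ltac vl_reify t l :=
  lazymatch t with
  | vl_add ?x ?y =>
      let e := vl_reify x l in let f := vl_reify y l in constr:(VAdd e f)
  | vl_sub ?x ?y =>
      let e := vl_reify x l in let f := vl_reify y l in constr:(VAdd e (VOpp f))
  | vl_opp ?x => let e := vl_reify x l in constr:(VOpp e)
  | vl_scal ?a ?x => let e := vl_reify x l in constr:(VScal a e)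
  | vl_zero => constr:(VZero)
  | _ => let n := vl_index t l in constr:(VVar n)
  end.

(** [vl_sub] is reified as the sum with an opposite, so [change] works by conversion. Terms outside
    the linear operations are atoms, and one real equation per atom remains. *)
Ltac vring :=
  unfold op_sub, op_opp;
  lazymatch goal with
  | |- @eq (vl_car ?V) ?x ?y =>
      let l := vl_atoms x (@nil (vl_car V)) in
      let l := vl_atoms y l in
      let e := vl_reify x l in
      let f := vl_reify y l in
      change (veval l e = veval l f);
      apply veval_eq; cbn [vcoef all_below Nat.eqb length]; repeat split; first [ring | lra]
  end.

(** * Transport of inequalities along linear identities *)

Section Order.
Context {V : VectorLattice}.
Implicit Types x y z t : V.
Local Open Scope vl_scope.

Lemma le_of_le x y z t : z <= t -> y + z = x + t -> x <= y.
Proof.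
intros H E. apply (vl_le_add _ _ _ (y - t)) in H.
replace y with (t + (y - t)) by vring.
replace x with (z + (y - t)); [easy|].
transitivity ((y + z) - t); [vring|]. rewrite E. vring.
Qed.

Lemma le_add x y z t : x <= y -> z <= t -> x + z <= y + t.
Proof.
intros H K. apply vl_le_trans with (y + z); [now apply vl_le_add|].
apply (le_of_le _ _ _ _ K). vring.
Qed.
End Order.

(** [vle H] closes [x <= y] when [H : z <= t] and [y - x = t - z] identically. *)
Ltac vle H := refine (le_of_le _ _ _ _ H _); vring.

(** * Vector lattices *)

Section Lattice.
Context {V : VectorLattice}.
Implicit Types a b c d p n x y z t u v w : V.
Local Open Scope vl_scope.

Lemma le_scal_sub (r s : R) x : (r <= s)%R -> 0 <= x -> r *: x <= s *: x.
Proof.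
intros H K.
assert (L : (s - r)%R *: 0 <= (s - r)%R *: x) by (apply vl_le_scal; [lra|easy]).
vle L.
Qed.

Lemma le_half x : 0 <= x + x -> 0 <= x.
Proof.
intros H.
assert (L : (1/2)%R *: 0 <= (1/2)%R *: (x + x)) by (apply vl_le_scal; [lra|easy]).
vle L.
Qed.

Lemma le_opp x y : x <= y -> - y <= - x.
Proof. intros H. vle H. Qed.

Lemma inf_comm x y : x ⊓ y = y ⊓ x.
Proof.
apply vl_le_anti; apply vl_inf_greatest; (apply vl_inf_lbl || apply vl_inf_lbr).
Qed.

Lemma le_of_sub_ge0 x y : 0 <= y - x -> x <= y.
Proof. intros H. vle H. Qed.

Lemma le_abs x : x <= vl_abs x.
Proof. apply vl_sup_ubl. Qed.

Lemma opp_le_abs x : - x <= vl_abs x.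
Proof. apply vl_sup_ubr. Qed.

Lemma abs_ge0 x : 0 <= vl_abs x.
Proof.
apply le_half. assert (H := le_add _ _ _ _ (le_abs x) (opp_le_abs x)). vle H.
Qed.

Lemma abs_id x : 0 <= x -> vl_abs x = x.
Proof.
intros H. apply vl_le_anti; [|apply le_abs].
apply vl_sup_least; [apply vl_le_refl|].
apply vl_le_trans with 0; [vle H|easy].
Qed.

Lemma abs_opp_le x : vl_abs (- x) <= vl_abs x.
Proof.
apply vl_sup_least; [apply opp_le_abs|].
assert (H := le_abs x). vle H.
Qed.

Lemma abs_add x y : vl_abs (x + y) <= vl_abs x + vl_abs y.
Proof.
apply vl_sup_least.
- apply le_add; apply le_abs.
- assert (H := le_add _ _ _ _ (opp_le_abs x) (opp_le_abs y)). vle H.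
Qed.

Lemma pos_ge0 x : 0 <= x ⊔ 0.
Proof. apply vl_sup_ubr. Qed.

Lemma pos_le_abs x : x ⊔ 0 <= vl_abs x.
Proof. apply vl_sup_least; [apply le_abs|apply abs_ge0]. Qed.

Lemma neg_le_abs x : (- x) ⊔ 0 <= vl_abs x.
Proof. apply vl_sup_least; [apply opp_le_abs|apply abs_ge0]. Qed.

Lemma pos_eq_add_neg x : x ⊔ 0 = x + ((- x) ⊔ 0).
Proof.
apply vl_le_anti.
- apply vl_sup_least.
  + assert (H := vl_sup_ubr _ (- x) 0). vle H.
  + assert (H := vl_sup_ubl _ (- x) 0). vle H.
- assert (H : (- x) ⊔ 0 <= (x ⊔ 0) - x).
  { apply vl_sup_least.
    - assert (H := vl_sup_ubr _ x 0). vle H.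
    - assert (H := vl_sup_ubl _ x 0). vle H. }
  vle H.
Qed.

(** Subadditivity of the meet with [w], stated for minorants: [z - u] and [z - w] both lie below
    [v ⊓ w], hence [z - v ⊓ w] lies below [u] and [w]. *)
Lemma le_add_inf u v w z :
  0 <= u -> 0 <= v -> 0 <= w -> z <= u + v -> z <= w -> z <= u ⊓ w + v ⊓ w.
Proof.
intros Hu Hv Hw H K.
assert (L : z - v ⊓ w <= u ⊓ w).
{ assert (Hzw : z - w <= 0) by vle K.
  apply vl_inf_greatest.
  - assert (L : z - u <= v ⊓ w).
    { apply vl_inf_greatest; [vle H|].
      apply vl_le_trans with z; [|easy]; vle Hu. }
    vle L.
  - assert (L : z - w <= v ⊓ w).
    { apply vl_le_trans with 0; [easy|]. now apply vl_inf_greatest. }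
    vle L. }
vle L.
Qed.

(** * Disjoint elements *)

Lemma disjP x y :
  x ⟂ y <-> forall z, z <= vl_abs x -> z <= vl_abs y -> z <= 0.
Proof.
unfold vl_disj. split.
- intros H z Hx Hy. rewrite <- H. now apply vl_inf_greatest.
- intros H. apply vl_le_anti.
  + apply H; [apply vl_inf_lbl|apply vl_inf_lbr].
  + apply vl_inf_greatest; apply abs_ge0.
Qed.

Lemma disj_sym x y : x ⟂ y -> y ⟂ x.
Proof. unfold vl_disj. now rewrite inf_comm. Qed.

Lemma disj_le x y u v :
  vl_abs u <= vl_abs x -> vl_abs v <= vl_abs y -> x ⟂ y -> u ⟂ v.
Proof.
intros Hu Hv H. apply disjP. intros z Hz Kz. rewrite disjP in H.
apply H; [now apply vl_le_trans with (vl_abs u)|now apply vl_le_trans with (vl_abs v)].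
Qed.

Lemma disj_posP x y : 0 <= x -> 0 <= y ->
  x ⟂ y <-> forall z, z <= x -> z <= y -> z <= 0.
Proof. intros Hx Hy. rewrite disjP. now rewrite !abs_id. Qed.

Lemma disj_add x y z : x ⟂ z -> y ⟂ z -> x + y ⟂ z.
Proof.
intros Hx Hy. apply disjP. intros t Ht Kt.
assert (H : t <= vl_abs x ⊓ vl_abs z + vl_abs y ⊓ vl_abs z).
{ apply le_add_inf; try apply abs_ge0; [|easy].
  eapply vl_le_trans; [apply Ht|apply abs_add]. }
rewrite Hx, Hy in H. now rewrite addr0 in H.
Qed.

Lemma disj_opp x y : x ⟂ y -> - x ⟂ y.
Proof. apply disj_le; [apply abs_opp_le|apply vl_le_refl]. Qed.

Lemma disj_sub x y z : x ⟂ z -> y ⟂ z -> x - y ⟂ z.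
Proof. intros Hx Hy. apply disj_add; [easy|now apply disj_opp]. Qed.

Lemma disj0 x : 0 ⟂ x.
Proof.
apply disjP. intros z Hz _. rewrite abs_id in Hz; [easy|apply vl_le_refl].
Qed.

Lemma scal_le_abs (r : R) x : r *: x <= Rabs r *: vl_abs x.
Proof.
unfold Rabs. destruct (Rcase_abs r).
- assert (H : (- r) *: - x <= (- r) *: vl_abs x) by (apply vl_le_scal; [lra|apply opp_le_abs]).
  vle H.
- apply vl_le_scal; [lra|apply le_abs].
Qed.

(** Natural multiples of [vl_abs x] follow from [disj_add], and one of them dominates the modulus of
    [r *: x]. *)
Lemma disj_scal (r : R) x z : x ⟂ z -> r *: x ⟂ z.
Proof.
intros H.
assert (Hn : forall k, INR k *: vl_abs x ⟂ z).
{ induction k as [|k IH].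
  - replace (INR 0 *: vl_abs x) with (0 : V) by (simpl; symmetry; apply scal0). apply disj0.
  - rewrite S_INR, vl_scalDl. apply disj_add; [easy|].
    rewrite vl_scal1. revert H. apply disj_le; [|apply vl_le_refl].
    rewrite (abs_id (vl_abs x)); [apply vl_le_refl|apply abs_ge0]. }
destruct (INR_unbounded (Rabs r)) as [k Hk].
assert (Hle : Rabs r *: vl_abs x <= INR k *: vl_abs x)
  by (apply le_scal_sub; [lra|apply abs_ge0]).
assert (Hr : Rabs r *: 0 <= Rabs r *: vl_abs x)
  by (apply vl_le_scal; [apply Rabs_pos|apply abs_ge0]).
rewrite scalr0 in Hr.
generalize (Hn k). apply disj_le; [|apply vl_le_refl].
rewrite (abs_id (INR k *: _)) by (eapply vl_le_trans; eassumption).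
eapply vl_le_trans; [|exact Hle].
apply vl_sup_least; [apply scal_le_abs|].
rewrite <- (Rabs_Ropp r). replace (- (r *: x)) with ((- r)%R *: x) by vring.
apply scal_le_abs.
Qed.

Lemma disj_self x : x ⟂ x -> x = 0.
Proof.
intros H. rewrite disjP in H.
apply vl_le_anti; [apply H; apply le_abs|].
assert (K : - x <= 0) by (apply H; apply opp_le_abs). vle K.
Qed.

(** From [|u| <= |u + v| + |v|], meet with [|u|]: the term coming from [v] vanishes. *)
Lemma disj_abs_le u v : u ⟂ v -> vl_abs u <= vl_abs (u + v).
Proof.
intros H.
assert (K : vl_abs u <= vl_abs (u + v) ⊓ vl_abs u + vl_abs v ⊓ vl_abs u).
{ apply le_add_inf; try apply abs_ge0; [|apply vl_le_refl].
  replace (vl_abs u) with (vl_abs ((u + v) + - v)) by (f_equal; vring).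
  eapply vl_le_trans; [apply abs_add|].
  apply le_add; [apply vl_le_refl|apply abs_opp_le]. }
apply disj_sym in H. rewrite H, addr0 in K.
eapply vl_le_trans; [exact K|apply vl_inf_lbl].
Qed.

Lemma disj_add_ge0 x y : x ⟂ y -> 0 <= x + y -> 0 <= x.
Proof.
intros H K. rewrite disjP in H.
assert (L : - x <= 0).
{ apply H; [apply opp_le_abs|]. apply vl_le_trans with y; [vle K|apply le_abs]. }
vle L.
Qed.

(** Subtracting a common minorant from [x ⊔ 0] leaves an upper bound of [x] and [0], so the minorant
    is at most [0]. *)
Lemma pos_disj_neg x : (x ⊔ 0) ⟂ ((- x) ⊔ 0).
Proof.
apply disj_posP; try apply pos_ge0. intros z Hp Hn.
assert (H : x ⊔ 0 <= (x ⊔ 0) - z).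
{ apply vl_sup_least; [|vle Hp].
  apply (le_of_le _ _ _ _ Hn). rewrite (pos_eq_add_neg x). vring. }
vle H.
Qed.

(** The excess [u + v - a] is a common minorant of [u] and [v]. *)
Lemma disj_add_le_ub u v a : 0 <= u -> 0 <= v -> u ⟂ v -> u <= a -> v <= a -> u + v <= a.
Proof.
intros Hu Hv H Hua Hva. rewrite disj_posP in H by easy.
assert (K : u + v - a <= 0) by (apply H; [vle Hva|vle Hua]).
vle K.
Qed.

(** Minimality of the disjoint decomposition: [p <= p' + n], and the meet of [n] with [p] is
    zero. *)
Lemma disj_sub_le p n p' n' : 0 <= p -> 0 <= n -> 0 <= p' -> 0 <= n' ->
  p ⟂ n -> p - n = p' - n' -> p <= p'.
Proof.
intros Hp Hn Hp' Hn' H E.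
assert (K : p <= p' ⊓ p + n ⊓ p).
{ apply le_add_inf; try easy; [|apply vl_le_refl].
  apply (le_of_le _ _ _ _ Hn'). transitivity ((p - n) + n + n'); [rewrite E|]; vring. }
apply disj_sym in H. unfold vl_disj in H. rewrite !abs_id in H by easy.
rewrite H, addr0 in K. eapply vl_le_trans; [exact K|apply vl_inf_lbl].
Qed.

Lemma inf_disj_split a b c d : 0 <= a -> 0 <= b -> 0 <= c -> 0 <= d ->
  c ⟂ d -> a + b = c + d -> a = a ⊓ c + a ⊓ d.
Proof.
intros Ha Hb Hc Hd H E. apply vl_le_anti.
- rewrite !(inf_comm a). apply le_add_inf; try easy; [|apply vl_le_refl].
  rewrite <- E. vle Hb.
- apply disj_add_le_ub; try (now apply vl_inf_greatest); try apply vl_inf_lbl.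
  revert H; apply disj_le.
  + rewrite !abs_id; try easy; [apply vl_inf_lbr|now apply vl_inf_greatest].
  + rewrite !abs_id; try easy; [apply vl_inf_lbr|now apply vl_inf_greatest].
Qed.

(* For [z + w = x + x'] with [z], [w] disjoint and [x], [x'] disjoint,
   [common_part z x] is the component of [z] carried by [x]. *)
Definition common_part z x : V := (z ⊔ 0) ⊓ (x ⊔ 0) - ((- z) ⊔ 0) ⊓ ((- x) ⊔ 0).

Lemma common_partC z x : common_part z x = common_part x z.
Proof. unfold common_part. now rewrite (inf_comm (z ⊔ 0)), (inf_comm ((- z) ⊔ 0)). Qed.

Lemma common_part_le z x : vl_abs (common_part z x) <= vl_abs z.
Proof.
unfold common_part.
assert (Hp : 0 <= (z ⊔ 0) ⊓ (x ⊔ 0)) by (apply vl_inf_greatest; apply pos_ge0).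
assert (Hn : 0 <= ((- z) ⊔ 0) ⊓ ((- x) ⊔ 0)) by (apply vl_inf_greatest; apply pos_ge0).
apply vl_sup_least.
- apply vl_le_trans with ((z ⊔ 0) ⊓ (x ⊔ 0)); [vle Hn|].
  eapply vl_le_trans; [apply vl_inf_lbl|apply pos_le_abs].
- apply vl_le_trans with (((- z) ⊔ 0) ⊓ ((- x) ⊔ 0)); [vle Hp|].
  eapply vl_le_trans; [apply vl_inf_lbl|apply neg_le_abs].
Qed.

Lemma pos_neg_disj_add z w : z ⟂ w ->
  (z ⊔ 0) + (w ⊔ 0) ⟂ ((- z) ⊔ 0) + ((- w) ⊔ 0).
Proof.
intros H.
assert (P : forall x, vl_abs (x ⊔ 0) <= vl_abs x)
  by (intros x; rewrite (abs_id (x ⊔ 0)) by apply pos_ge0; apply pos_le_abs).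
assert (N : forall x, vl_abs ((- x) ⊔ 0) <= vl_abs x)
  by (intros x; rewrite (abs_id ((- x) ⊔ 0)) by apply pos_ge0; apply neg_le_abs).
apply disj_add; apply disj_sym, disj_add; apply disj_sym; try apply pos_disj_neg.
- now apply (disj_le z w).
- apply (disj_le w z); [easy|easy|now apply disj_sym].
Qed.

(** Disjointness makes the left side the positive part of [z + w], which is the least one among all
    differences of positive elements representing it. *)
Lemma pos_disj_add_le z w x y : z ⟂ w -> z + w = x + y ->
  (z ⊔ 0) + (w ⊔ 0) <= (x ⊔ 0) + (y ⊔ 0).
Proof.
assert (A : forall u v, 0 <= (u ⊔ 0) + (v ⊔ 0)).
{ intros u v. rewrite <- (addr0 0) at 1. apply le_add; apply pos_ge0. }
intros H E.
apply disj_sub_le with (((- z) ⊔ 0) + ((- w) ⊔ 0)) (((- x) ⊔ 0) + ((- y) ⊔ 0)); try apply A.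
- now apply pos_neg_disj_add.
- transitivity (z + w); [rewrite (pos_eq_add_neg z), (pos_eq_add_neg w); vring|].
  rewrite E, (pos_eq_add_neg x), (pos_eq_add_neg y). vring.
Qed.

(** The sums of the positive parts agree, and so do those of the negative parts; [inf_disj_split]
    refines each of them, and the difference gives [z]. *)
Lemma common_part_split z w x y : z ⟂ w -> x ⟂ y -> z + w = x + y ->
  z = common_part z x + common_part z y.
Proof.
intros Hzw Hxy E.
assert (D : forall u v, u ⟂ v -> (u ⊔ 0) ⟂ (v ⊔ 0)).
{ intros u v. apply disj_le; rewrite (abs_id (_ ⊔ 0)) by apply pos_ge0; apply pos_le_abs. }
assert (Hp : z ⊔ 0 = (z ⊔ 0) ⊓ (x ⊔ 0) + (z ⊔ 0) ⊓ (y ⊔ 0)).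
{ apply inf_disj_split with (w ⊔ 0); try apply pos_ge0; [now apply D|].
  apply vl_le_anti; now apply pos_disj_add_le. }
assert (Hn : (- z) ⊔ 0 = ((- z) ⊔ 0) ⊓ ((- x) ⊔ 0) + ((- z) ⊔ 0) ⊓ ((- y) ⊔ 0)).
{ assert (M : forall u v, u ⟂ v -> - u ⟂ - v)
    by (intros u v Huv; apply disj_opp, disj_sym, disj_opp, disj_sym, Huv).
  assert (E' : - z + - w = - x + - y)
    by (transitivity (- (z + w)); [vring|rewrite E; vring]).
  apply inf_disj_split with ((- w) ⊔ 0); try apply pos_ge0; [now apply D, M|].
  apply vl_le_anti; apply pos_disj_add_le; auto. }
transitivity ((z ⊔ 0) - ((- z) ⊔ 0)); [rewrite (pos_eq_add_neg z); vring|].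
rewrite Hp, Hn. unfold common_part. vring.
Qed.

(** * Fragments *)

Lemma fragment_abs_le x y : fragment x y -> vl_abs y <= vl_abs x.
Proof.
intros H. replace x with (y + (x - y)) by vring. now apply disj_abs_le.
Qed.

Lemma fragment_compl x y : fragment x y -> fragment x (x - y).
Proof.
unfold fragment. intros H. replace (x - (x - y)) with y by vring. now apply disj_sym.
Qed.

Lemma fragment0 x : fragment x 0.
Proof. apply disj0. Qed.

Lemma fragment_refl x : fragment x x.
Proof. unfold fragment. replace (x - x) with (0 : V) by vring. apply disj_sym, disj0. Qed.

Lemma fragment_disj x x' y y' : x ⟂ x' -> fragment x y -> fragment x' y' -> y ⟂ y'.
Proof. intros H Hy Hy'. revert H. apply disj_le; now apply fragment_abs_le. Qed.

Lemma fragment_add x x' y y' : x ⟂ x' -> fragment x y -> fragment x' y' ->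
  fragment (x + x') (y + y').
Proof.
intros H Hy Hy'. unfold fragment.
replace (x + x' - (y + y')) with ((x - y) + (x' - y')) by vring.
apply disj_add; apply disj_sym, disj_add; try (now apply disj_sym).
- apply (fragment_disj x' x); auto using fragment_compl, disj_sym.
- apply (fragment_disj x x'); auto using fragment_compl.
Qed.

(** With [w] the complement of [z], the components of [z] and [w] carried by [x] add up to [x] and
    inherit disjointness from [z] and [w]; the same holds for [x']. *)
Lemma fragment_add_inv x x' z : x ⟂ x' -> fragment (x + x') z ->
  exists y y', fragment x y /\ fragment x' y' /\ z = y + y'.
Proof.
intros H Hz. unfold fragment in Hz. set (w := x + x' - z) in Hz.
assert (E : z + w = x + x') by (unfold w; vring).
assert (Ez := common_part_split z w x x' Hz H E).
assert (Ew : w = common_part w x + common_part w x').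
{ apply common_part_split with z; [now apply disj_sym|easy|].
  rewrite <- E; vring. }
assert (Hwz : w ⟂ z) by now apply disj_sym.
assert (Ex : x = common_part z x + common_part w x).
{ rewrite !(common_partC _ x). now apply common_part_split with x'. }
assert (Ex' : x' = common_part z x' + common_part w x').
{ rewrite !(common_partC _ x').
  apply common_part_split with x; [now apply disj_sym|easy|].
  rewrite E; vring. }
assert (F : forall u, u = common_part z u + common_part w u -> fragment u (common_part z u)).
{ intros u Eu. unfold fragment.
  replace (u - common_part z u) with (common_part w u) by (rewrite Eu at 2; vring).
  revert Hz. apply disj_le; apply common_part_le. }
exists (common_part z x), (common_part z x'). auto.
Qed.
End Lattice.

(** * Band projections *)

Section BandProjection.
Context {F : VectorLattice}.
Implicit Types x y z t u v w : F.
Implicit Type B : F -> Prop.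
Local Open Scope vl_scope.

(** Closure under suprema is the substantial point. Fix [d0] in [D]; a positive common minorant [z']
    of [s - d0] and [vl_abs w] is disjoint from each [(d ⊔ d0) - d0], so their sum stays below
    [s - d0]. Thus [s - z'] still bounds [D], which forces [z' <= 0]. *)
Lemma disj_band w : is_band (fun x => x ⟂ w).
Proof.
split; [apply disj0|]. split; [intros x y; apply disj_add|].
split; [intros r x; apply disj_scal|].
split; [intros x y H; apply disj_le; [exact H|apply vl_le_refl]|].
intros D s HD [Hub Hle]. destruct (classic (exists d, D d)) as [[d0 Hd0]|HN].
- replace s with (d0 + (s - d0)) by vring. apply disj_add; [now apply HD|].
  assert (Hs0 : 0 <= s - d0) by (assert (H := Hub _ Hd0); vle H).
  apply disjP. intros z Hz Kz. rewrite abs_id in Hz by easy.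
  set (z' := z ⊔ 0).
  assert (Hz' : z' <= s - d0) by now apply vl_sup_least.
  assert (Kz' : z' <= vl_abs w) by (apply vl_sup_least; [easy|apply abs_ge0]).
  assert (H0 : 0 <= z') by apply vl_sup_ubr.
  assert (L : s <= s - z').
  { apply Hle. intros d Hd. set (e := (d ⊔ d0) - d0).
    assert (He : 0 <= e) by (assert (H := vl_sup_ubr _ d d0); unfold e; vle H).
    assert (Hew : e ⟂ w).
    { assert (K : (d - d0) ⟂ w) by (apply disj_sub; auto).
      revert K. apply disj_le; [|apply vl_le_refl].
      rewrite (abs_id e) by easy.
      assert (M : d ⊔ d0 <= vl_abs (d - d0) + d0).
      { apply vl_sup_least.
        - assert (M := le_abs (d - d0)). vle M.
        - assert (M := abs_ge0 (d - d0)). vle M. }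
      unfold e. vle M. }
    assert (Hes : e <= s - d0).
    { assert (M : d ⊔ d0 <= s) by (apply vl_sup_least; auto). unfold e. vle M. }
    assert (K : e + z' <= s - d0).
    { apply disj_add_le_ub; try easy. apply disj_sym in Hew. apply disj_sym.
      revert Hew. apply disj_le; [|apply vl_le_refl].
      now rewrite (abs_id z'). }
    assert (N := le_add _ _ _ _ (vl_sup_ubl _ d d0) K). unfold e in N. vle N. }
  apply vl_le_trans with z'; [apply vl_sup_ubl|vle L].
(* For empty [D] every element is an upper bound, so [s <= s - z] for all [z]. *)
- apply disjP. intros z _ _.
  assert (L : s <= s - z) by (apply Hle; intros d Hd; exfalso; eauto).
  vle L.
Qed.

(** The body of [band_proj] at one point, as a relation, so that uniqueness and linearity can be
    shown before existence. *)
Definition band_component B z r := B r /\ forall b, B b -> z - r ⟂ b.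

Lemma band_component_uniq B z r r' : is_band B ->
  band_component B z r -> band_component B z r' -> r = r'.
Proof.
intros [_ [Badd [Bscal _]]] [Hr Kr] [Hr' Kr'].
assert (Hd : B (r - r')).
{ replace (r - r') with (r + (-1)%R *: r') by vring. auto. }
assert (H : r - r' = 0).
{ apply disj_self. replace (r - r') with ((z - r') - (z - r)) at 1 by vring.
  apply disj_sub; auto. }
replace r with ((r - r') + r') by vring. now rewrite H, vl_add0.
Qed.

Lemma band_component_add B z z' r r' : is_band B ->
  band_component B z r -> band_component B z' r' -> band_component B (z + z') (r + r').
Proof.
intros [_ [Badd _]] [Hr Kr] [Hr' Kr']. split; [auto|]. intros b Hb.
replace (z + z' - (r + r')) with ((z - r) + (z' - r')) by vring.
apply disj_add; auto.
Qed.

Lemma band_component_scal B (a : R) z r : is_band B ->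
  band_component B z r -> band_component B (a *: z) (a *: r).
Proof.
intros [_ [_ [Bscal _]]] [Hr Kr]. split; [auto|]. intros b Hb.
replace (a *: z - a *: r) with (a *: (z - r)) by vring.
apply disj_scal; auto.
Qed.

Hypothesis HF : dedekind_complete F.

(** The supremum [s] of all [- (e *: k)] satisfies [s <= s + s], by halving [e]; hence
    [0 <= s <= y - x]. *)
Lemma archimedean_le x y k : 0 <= k ->
  (forall e : R, (0 < e)%R -> x <= y + e *: k) -> x <= y.
Proof.
intros Hk H.
destruct (HF (fun v => exists e : R, (0 < e)%R /\ v = - (e *: k))) as [s [Hub Hle]].
- exists (- (1 *: k)), 1%R. split; [lra|easy].
- exists 0. intros d [e [He ->]].
  assert (L : e *: 0 <= e *: k) by (apply vl_le_scal; [lra|easy]). vle L.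
- assert (Hs : s <= s + s).
  { apply Hle. intros d [e [He ->]].
    assert (L : - ((e / 2) *: k) <= s) by (apply Hub; exists (e / 2)%R; split; [lra|easy]).
    assert (M := le_add _ _ _ _ L L).
    replace (- (e *: k)) with (- ((e / 2) *: k) + - ((e / 2) *: k)); [easy|].
    transitivity (- ((e / 2 + e / 2)%R *: k)); [vring|]. do 2 f_equal. lra. }
  assert (K : s <= y - x).
  { apply Hle. intros d [e [He ->]]. assert (L := H e He). vle L. }
  apply (le_of_le _ _ _ _ (vl_le_trans _ _ _ _ (le_of_le 0 s s (s + s) Hs ltac:(vring)) K)).
  vring.
Qed.

Lemma exists_inf (D : F -> Prop) : (exists d, D d) -> (exists b, is_lb D b) ->
  exists s, is_inf D s.
Proof.
intros [d0 H0] [b Hb].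
destruct (HF (fun v => D (- v))) as [s [Hub Hle]].
- exists (- d0). now replace (- - d0) with d0 by vring.
- exists (- b). intros d Hd. assert (L := Hb _ Hd). vle L.
- exists (- s). split.
  + intros d Hd. assert (L : - d <= s) by (apply Hub; now replace (- - d) with d by vring).
    vle L.
  + intros c Hc. assert (L : s <= - c) by (apply Hle; intros d Hd; assert (M := Hc _ Hd); vle M).
    vle L.
Qed.

(** For positive [z] the component is the supremum [r] of the members of [B] between [0] and [z]: a
    positive minorant of [z - r] and [vl_abs b] lies in [B] and could be added to each of them. The
    general case subtracts the components of the two parts of [z]. *)
Lemma exists_band_proj B : is_band B -> exists rho, forall z, band_component B z (rho z).
Proof.
intros HB. apply functional_choice.
assert (Hpos : forall z, 0 <= z -> exists r, band_component B z r).
{ intros z Hz. assert (HB' := HB). destruct HB' as [B0 [Badd [_ [Bid Bsup]]]].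
  destruct (HF (fun b => B b /\ 0 <= b /\ b <= z)) as [r Hr].
  - exists 0. split; [easy|split; [apply vl_le_refl|easy]].
  - exists z. now intros d [_ [_ Hd]].
  - exists r. split; [apply (Bsup _ r) in Hr; [easy|now intros d [Hd _]]|].
    intros b Hb. destruct Hr as [Hub Hle].
    assert (Hr0 : 0 <= r) by (apply Hub; repeat split; [easy|apply vl_le_refl|easy]).
    assert (Hrz : 0 <= z - r).
    { assert (L : r <= z) by (apply Hle; now intros d [_ [_ Hd]]). vle L. }
    apply disjP. intros t Ht Kt. rewrite abs_id in Ht by easy.
    set (t' := t ⊔ 0).
    assert (Ht0 : 0 <= t') by apply vl_sup_ubr.
    assert (Ht' : t' <= z - r) by now apply vl_sup_least.
    assert (L : r <= r - t').
    { apply Hle. intros d [Hd [Hd0 Hdz]].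
      assert (L : d + t' <= r).
      { apply Hub. split; [|split].
        - apply Badd; [easy|]. apply (Bid _ b); [|easy]. rewrite abs_id by easy.
          apply vl_sup_least; [easy|apply abs_ge0].
        - rewrite <- (addr0 0). now apply le_add.
        - assert (L : d <= r) by (apply Hub; auto).
          assert (M := le_add _ _ _ _ L Ht'). vle M. }
      vle L. }
    apply vl_le_trans with t'; [apply vl_sup_ubl|vle L]. }
intros z.
destruct (Hpos (z ⊔ 0)) as [r Hr]; [apply pos_ge0|].
destruct (Hpos ((- z) ⊔ 0)) as [r' Hr']; [apply pos_ge0|].
exists (r + (-1)%R *: r').
replace z with (z ⊔ 0 + (-1)%R *: ((- z) ⊔ 0)) by (rewrite (pos_eq_add_neg z); vring).
apply band_component_add; [easy|easy|]. now apply band_component_scal.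
Qed.

Lemma exists_disj_band_proj w : exists rho, band_proj rho /\
  (forall v, v ⟂ w -> rho v = v) /\ rho w = 0.
Proof.
assert (HB := disj_band w).
destruct (exists_band_proj _ HB) as [rho Hrho]. exists rho. repeat split.
- now exists (fun x => x ⟂ w).
- intros v Hv. apply (band_component_uniq _ v _ _ HB (Hrho v)). split; [easy|].
  intros b _. replace (v - v) with (0 : F) by vring. apply disj0.
- apply (band_component_uniq _ w _ _ HB (Hrho w)). split; [apply disj0|].
  intros b Hb. replace (w - 0) with w by vring. now apply disj_sym.
Qed.

(** * Linearity and monotonicity of a band projection *)

Variable rho : F -> F.
Hypothesis Hrho : band_proj rho.

Lemma band_projD x y : rho (x + y) = rho x + rho y.
Proof.
destruct Hrho as [B [HB H]].
apply (band_component_uniq B (x + y)); [easy|apply H|]. now apply band_component_add; [|apply H|apply H].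
Qed.

Lemma band_projZ a x : rho (a *: x) = a *: rho x.
Proof.
destruct Hrho as [B [HB H]].
apply (band_component_uniq B (a *: x)); [easy|apply H|]. apply band_component_scal; [easy|apply H].
Qed.

Lemma band_projB x y : rho (x - y) = rho x - rho y.
Proof.
replace (x - y) with (x + (-1)%R *: y) by vring.
rewrite band_projD, band_projZ. vring.
Qed.

Lemma band_projK x : rho (rho x) = rho x.
Proof.
destruct Hrho as [B [HB H]].
apply (band_component_uniq B (rho x)); [easy|apply H|]. split; [apply H|].
intros b _. replace (rho x - rho x) with (0 : F) by vring. apply disj0.
Qed.

Lemma band_proj_disj x : rho x ⟂ (x - rho x).
Proof. destruct Hrho as [B [HB H]]. apply disj_sym. apply H, H. Qed.

Lemma band_proj_ge0 x : 0 <= x -> 0 <= rho x.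
Proof.
intros Hx. apply disj_add_ge0 with (x - rho x); [apply band_proj_disj|].
vle Hx.
Qed.

Lemma band_proj_le_id x : 0 <= x -> rho x <= x.
Proof.
intros Hx. apply le_of_sub_ge0. apply disj_add_ge0 with (rho x); [apply disj_sym, band_proj_disj|].
vle Hx.
Qed.

Lemma band_proj_le x y : x <= y -> rho x <= rho y.
Proof.
intros H. apply le_of_sub_ge0. rewrite <- band_projB. apply band_proj_ge0. vle H.
Qed.

Lemma band_proj_compl_le x y : x <= y -> x - rho x <= y - rho y.
Proof.
intros H.
assert (K : rho (y - x) <= y - x) by (apply band_proj_le_id; vle H).
rewrite band_projB in K. vle K.
Qed.
End BandProjection.

(** * Orthogonally additive operators *)

Section Operators.
Context {E F : VectorLattice}.
Implicit Types S Q T P W : E -> F.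
Local Open Scope vl_scope.

Lemma op_leP S T : op_le S T <-> forall x, S x <= T x.
Proof.
split; intros H x.
- apply le_of_sub_ge0, H.
- assert (K := H x). vle K.
Qed.

Lemma orth_additive0 T : orth_additive T -> T 0 = 0.
Proof.
intros H. apply (addIr (T 0)). rewrite <- H by apply disj0. now rewrite !vl_add0.
Qed.

Lemma orth_additive_fragment T x y : orth_additive T -> fragment x y ->
  T x = T y + T (x - y).
Proof. intros H Hy. rewrite <- H by easy. f_equal. vring. Qed.

Lemma pos_fragment_le T x y : orth_additive T -> (forall z, 0 <= T z) ->
  fragment x y -> T y <= T x.
Proof.
intros H H0 Hy. rewrite (orth_additive_fragment T x y) by easy.
assert (K := H0 (x - y)). vle K.
Qed.

Lemma inU_dominated W S : orth_additive W -> (forall x, 0 <= W x) ->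
  (forall x, W x <= S x) -> inU S -> inU W.
Proof.
intros HW H0 Hle [_ HS]. split; [easy|]. intros D HD.
destruct (HS D HD) as [a [b Hab]]. exists 0, b. intros d [z [Hz ->]].
split; [easy|]. apply vl_le_trans with (S z); [easy|].
apply Hab. now exists z.
Qed.

(** The set whose infimum is the value at [x] of the meet of [S] and [Q] in U(E,F), for positive [S]
    and [Q]. *)
Definition fragment_sums S Q (x : E) (v : F) : Prop :=
  exists y, fragment x y /\ v = S y + Q (x - y).

Hypothesis HF : dedekind_complete F.

(** For disjoint [x] and [x'] the fragments of [x + x'] are exactly the sums of fragments, so the
    infimum splits; it is taken over [y] with [y'] fixed, then over [y']. *)
Lemma exists_op_inf S Q : orth_additive S -> orth_additive Q ->
  (forall x, 0 <= S x) -> (forall x, 0 <= Q x) ->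
  exists W, orth_additive W /\ forall x, is_inf (fragment_sums S Q x) (W x).
Proof.
intros HS HQ S0 Q0.
destruct (functional_choice (fun x => is_inf (fragment_sums S Q x))) as [W HW].
{ intros x. apply exists_inf; [easy| |].
  - exists (S 0 + Q (x - 0)), 0. split; [apply fragment0|easy].
  - exists 0. intros d [y [Hy ->]]. rewrite <- (addr0 0). now apply le_add. }
exists W. split; [|easy]. intros x x' Hxx'. apply vl_le_anti.
- assert (K : forall y', fragment x' y' -> W (x + x') - (S y' + Q (x' - y')) <= W x).
  { intros y' Hy'. apply (HW x). intros d [y [Hy ->]].
    assert (L : W (x + x') <= S (y + y') + Q (x + x' - (y + y'))).
    { apply (HW (x + x')). exists (y + y'). split; [|easy]. now apply fragment_add. }
    rewrite HS in L by now apply (fragment_disj x x').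
    replace (x + x' - (y + y')) with ((x - y) + (x' - y')) in L by vring.
    rewrite HQ in L by (apply (fragment_disj x x'); auto using fragment_compl).
    vle L. }
  assert (L : W (x + x') - W x <= W x').
  { apply (HW x'). intros d [y' [Hy' ->]]. assert (L := K y' Hy'). vle L. }
  vle L.
- apply (HW (x + x')). intros d [z [Hz ->]].
  destruct (fragment_add_inv x x' z Hxx' Hz) as [y [y' [Hy [Hy' ->]]]].
  rewrite HS by now apply (fragment_disj x x').
  replace (x + x' - (y + y')) with ((x - y) + (x' - y')) by vring.
  rewrite HQ by (apply (fragment_disj x x'); auto using fragment_compl).
  assert (L : W x <= S y + Q (x - y)) by (apply (HW x); now exists y).
  assert (L' : W x' <= S y' + Q (x' - y')) by (apply (HW x'); now exists y').
  assert (M := le_add _ _ _ _ L L'). vle M.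
Qed.

(** The fragments [x] and [0] give the bounds by [S] and [Q]; a common minorant [V] splits along
    each fragment. *)
Lemma op_inf_spec S Q W : orth_additive S -> orth_additive Q ->
  (forall x, 0 <= S x) -> (forall x, 0 <= Q x) ->
  (forall x, is_inf (fragment_sums S Q x) (W x)) ->
  (forall x, 0 <= W x) /\ (forall x, W x <= S x) /\ (forall x, W x <= Q x) /\
  forall V, orth_additive V -> (forall x, V x <= S x) -> (forall x, V x <= Q x) ->
    forall x, V x <= W x.
Proof.
intros HS HQ S0 Q0 HW. repeat split.
- intros x. apply (HW x). intros d [y [_ ->]]. rewrite <- (addr0 0). now apply le_add.
- intros x. apply (HW x). exists x. split; [apply fragment_refl|].
  replace (x - x) with (0 : E) by vring. now rewrite (orth_additive0 Q), addr0.
- intros x. apply (HW x). exists 0. split; [apply fragment0|].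
  replace (x - 0) with x by vring. now rewrite (orth_additive0 S), vl_add0.
- intros V HV VS VQ x. apply (HW x). intros d [y [Hy ->]].
  rewrite (orth_additive_fragment V x y) by easy. now apply le_add.
Qed.

(** The pointwise supremum is orthogonally additive because directedness bounds [W' x + W x'] by one
    [W''] at [x + x']. *)
Lemma exists_directed_sup (M : (E -> F) -> Prop) P :
  (exists W, M W) ->
  (forall W W', M W -> M W' ->
     exists W'', M W'' /\ (forall x, W x <= W'' x) /\ (forall x, W' x <= W'' x)) ->
  (forall W, M W -> orth_additive W /\ forall x, W x <= P x) ->
  exists G, orth_additive G /\ forall x, is_sup (fun v => exists W, M W /\ v = W x) (G x).
Proof.
intros [W0 HW0] Hdir HM.
destruct (functional_choice (fun x => is_sup (fun v => exists W, M W /\ v = W x))) as [G HG].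
{ intros x. apply HF.
  - now exists (W0 x), W0.
  - exists (P x). intros d [W [HW ->]]. now apply HM. }
assert (Gub : forall W x, M W -> W x <= G x) by (intros W x HW; apply (HG x); now exists W).
exists G. split; [|easy]. intros x x' Hxx'. apply vl_le_anti.
- apply (HG (x + x')). intros d [W [HW ->]]. destruct (HM W HW) as [HWa _].
  rewrite HWa by easy. apply le_add; auto.
- assert (K : forall W, M W -> G x <= G (x + x') - W x').
  { intros W HW. apply (HG x). intros d [W' [HW' ->]].
    destruct (Hdir W W' HW HW') as [W2 [H2 [L L']]].
    assert (K := Gub W2 (x + x') H2). destruct (HM W2 H2) as [H2a _].
    rewrite H2a in K by easy.
    assert (K2 := vl_le_trans _ _ _ _ (le_add _ _ _ _ (L' x) (L x')) K). vle K2. }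
  assert (L : G x' <= G (x + x') - G x).
  { apply (HG x'). intros d [W [HW ->]]. assert (L := K W HW). vle L. }
  vle L.
Qed.

(** * Disjointness of operators *)

Lemma inUp_abs S : inUp S -> is_abs_U S S.
Proof.
intros [HS S0]. split; [easy|]. split; [|split; [|easy]]; apply op_leP; intros x.
- apply vl_le_refl.
- assert (H := S0 x). apply vl_le_trans with 0; [unfold op_opp; vle H|easy].
Qed.

Lemma inU_op_zero : inU (op_zero : E -> F).
Proof.
split.
- intros x y _. unfold op_zero. now rewrite vl_add0.
- intros D _. exists 0, 0. intros d [z [_ ->]]. split; apply vl_le_refl.
Qed.

Lemma disj_U_le0 S R V x : disj_U S R -> inU V ->
  (forall y, V y <= S y) -> (forall y, V y <= R y) -> V x <= 0.
Proof.
intros [a [b [[_ [Sa _]] [[_ [Rb _]] [_ [_ [_ H]]]]]]] HV VS VR.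
rewrite op_leP in Sa, Rb.
assert (K : op_le V op_zero).
{ apply H; [easy| |]; apply op_leP; intros y;
    [now apply vl_le_trans with (S y)|now apply vl_le_trans with (R y)]. }
rewrite op_leP in K. apply K.
Qed.

Lemma pos_disj_U S R : inUp S -> inUp R ->
  (forall V, inU V -> (forall y, V y <= S y) -> (forall y, V y <= R y) ->
     forall x, V x <= 0) ->
  disj_U S R.
Proof.
intros HS HR H. exists S, R. split; [now apply inUp_abs|]. split; [now apply inUp_abs|].
split; [apply inU_op_zero|]. destruct HS as [_ S0], HR as [_ R0].
split; [|split]; [now apply op_leP|now apply op_leP|].
intros V HV VS VR. apply op_leP. rewrite op_leP in VS, VR. now apply H.
Qed.

Lemma disj_U_fragment_sums S Q x u : inUp S -> inUp Q -> disj_U Q S ->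
  (forall y, fragment x y -> u <= S y + Q (x - y)) -> u <= 0.
Proof.
intros [HS S0] [HQ Q0] H Hu.
destruct (exists_op_inf S Q) as [W [HW HWinf]]; try easy; [apply HS|apply HQ|].
destruct (op_inf_spec S Q W) as [W0 [WS [WQ _]]]; try easy; [apply HS|apply HQ|].
apply vl_le_trans with (W x).
- apply (HWinf x). intros d [y [Hy ->]]. auto.
- apply (disj_U_le0 Q S); try easy. now apply (inU_dominated W S).
Qed.

Lemma disj_U_sym S R : disj_U S R -> disj_U R S.
Proof.
intros [a [b [Ha [Hb [H0 [Wa [Wb H]]]]]]]. exists b, a.
split; [easy|]. split; [easy|]. split; [easy|]. split; [easy|]. split; [easy|auto].
Qed.

Lemma inU_opp S : inU S -> inU (op_opp S).
Proof.
intros [HS HSb]. split.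
- intros x y Hxy. unfold op_opp. rewrite HS by easy. vring.
- intros D HD. destruct (HSb D HD) as [a [b Hab]]. exists (- b), (- a).
  intros d [z [Hz ->]]. unfold op_opp.
  split; apply le_opp; apply Hab; now exists z.
Qed.

(** As [- S <= R], the operator [- S] lies below the moduli of both [S] and [R], whose meet is
    zero. *)
Lemma disj_U_add_ge0 S R : inU S -> disj_U S R -> (forall x, 0 <= S x + R x) ->
  forall x, 0 <= S x.
Proof.
intros HS [a [b [[_ [_ [Sa _]]] [[_ [Rb _]] [_ [_ [_ H]]]]]]] HSR x.
rewrite op_leP in Rb.
assert (K : op_le (op_opp S) op_zero).
{ apply H; [now apply inU_opp|easy|]. apply op_leP. intros y.
  apply vl_le_trans with (R y); [|easy]. assert (K := HSR y). unfold op_opp. vle K. }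
rewrite op_leP in K. assert (L := K x). unfold op_opp, op_zero in L. vle L.
Qed.

(** * The projection onto the band generated by a directed set *)

Section Projection.
Variable A : (E -> F) -> Prop.
Hypothesis HAp : forall S, A S -> inUp S.
Hypothesis HA : increasing_set A.
Variables T P : E -> F.
Hypothesis HT : inUp T.
Hypothesis HP : is_piA A T P.

Lemma inUp_piA : inUp P.
Proof.
destruct HP as [PU [[_ HPP] HTP]]. split; [easy|]. destruct HT as [_ T0].
apply (disj_U_add_ge0 P (op_sub T P)); [easy|now apply HPP|].
intros x. assert (H := T0 x). vle H.
Qed.

Lemma inUp_piA_compl : inUp (op_sub T P).
Proof.
destruct HP as [PU [[_ HPP] HTP]]. split; [apply HTP|]. destruct HT as [_ T0].
apply (disj_U_add_ge0 (op_sub T P) P); [apply HTP|now apply disj_U_sym, HPP|].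
intros x. assert (H := T0 x). vle H.
Qed.

(** The positive minorants of [P] in the order ideal generated by [A]. *)
Definition dominated_part W : Prop :=
  orth_additive W /\ (forall x, 0 <= W x) /\ (forall x, W x <= P x) /\
  exists (S : E -> F) (t : R), A S /\ (0 <= t)%R /\ forall x, W x <= t *: S x.

Lemma orth_additive_scal (t : R) S : orth_additive S -> orth_additive (fun x => t *: S x).
Proof. intros H x y Hxy. rewrite H by easy. vring. Qed.

(** A common majorant is the meet of [P] with [(t + t') *: V], where [V] in [A] lies above [S] and
    [S']. *)
Lemma dominated_part_directed W W' : dominated_part W -> dominated_part W' ->
  exists W'', dominated_part W'' /\ (forall x, W x <= W'' x) /\ (forall x, W' x <= W'' x).
Proof.
intros [HW [W0 [WP [S [t [AS [Ht WS]]]]]]] [HW' [W0' [WP' [S' [t' [AS' [Ht' WS']]]]]]].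
destruct HA as [_ Hdir]. destruct (Hdir S S' AS AS') as [V [AV [SV SV']]].
rewrite op_leP in SV, SV'.
destruct (HAp V AV) as [[HV _] V0]. destruct inUp_piA as [[HPa _] P0].
assert (K : forall x, 0 <= (t + t')%R *: V x).
{ intros x. assert (L : (t + t')%R *: 0 <= (t + t')%R *: V x)
    by (apply vl_le_scal; [lra|easy]). vle L. }
destruct (exists_op_inf P (fun x => (t + t')%R *: V x)) as [W2 [HW2 HW2inf]]; try easy;
  [now apply orth_additive_scal|].
destruct (op_inf_spec P (fun x => (t + t')%R *: V x) W2) as [C1 [C2 [C3 C4]]]; try easy;
  [now apply orth_additive_scal|].
assert (Hscal : forall (Z Z' : E -> F) r, (0 <= r <= t + t')%R ->
  (forall x, Z x <= r *: Z' x) -> (forall x, Z' x <= V x) ->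
  forall x, Z x <= (t + t')%R *: V x).
{ intros Z Z' r Hr HZ HZ' x. apply vl_le_trans with (r *: Z' x); [easy|].
  apply vl_le_trans with (r *: V x); [now apply vl_le_scal|now apply le_scal_sub]. }
exists W2. split; [|split].
- split; [easy|]. split; [easy|]. split; [easy|].
  exists V, (t + t')%R. repeat split; [easy|lra|easy].
- apply C4; [easy|easy|]. apply (Hscal W S t); [lra|easy|easy].
- apply C4; [easy|easy|]. apply (Hscal W' S' t'); [lra|easy|easy].
Qed.

(* If [G] is the supremum of the dominated parts, then [P - G] is disjoint from
   [A]: a minorant of both [P - G] and some [S] in [A] can be added to every
   dominated part. As [P] lies in the band generated by [A], [P = G]. *)
Lemma piA_le_of_dominated_parts x c :
  (forall W, dominated_part W -> W x <= c) -> P x <= c.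
Proof.
destruct inUp_piA as [PU P0]. assert (HPa := proj1 PU).
destruct (exists_directed_sup dominated_part P) as [G [HG Gsup]].
- destruct HA as [[S AS] _]. exists op_zero. split; [apply inU_op_zero|].
  split; [intros y; apply vl_le_refl|]. split; [easy|].
  exists S, 0%R. split; [easy|]. split; [lra|]. intros y.
  rewrite scal0. apply vl_le_refl.
- apply dominated_part_directed.
- now intros W [HW [_ [WP _]]].
- assert (Gub : forall W y, dominated_part W -> W y <= G y)
    by (intros W y HW; apply (Gsup y); now exists W).
  assert (GP : forall y, G y <= P y).
  { intros y. apply (Gsup y). intros d [W [[_ [_ [WP _]]] ->]]. easy. }
  assert (G0 : forall y, 0 <= G y).
  { intros y. destruct HA as [[S AS] _].
    apply (Gub op_zero). split; [apply inU_op_zero|].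
    split; [intros z; apply vl_le_refl|]. split; [easy|].
    exists S, 0%R. split; [easy|]. split; [lra|]. intros z.
    rewrite scal0. apply vl_le_refl. }
  assert (R0 : forall y, 0 <= op_sub P G y) by (intros y; assert (L := GP y); vle L).
  assert (RP : forall y, op_sub P G y <= P y) by (intros y; assert (L := G0 y); vle L).
  assert (Ra : orth_additive (op_sub P G)).
  { intros y z Hyz. unfold op_sub. rewrite HPa, HG by easy. vring. }
  assert (RU : inU (op_sub P G)) by now apply (inU_dominated _ P).
  assert (RA : perp_U A (op_sub P G)).
  { split; [easy|]. intros S AS. destruct (HAp S AS) as [SU S0].
    apply pos_disj_U; [easy|easy|]. intros V HV VR VS y.
    destruct (exists_op_inf (op_sub P G) S) as [W [HW Winf]]; try easy; [apply SU|].
    destruct (op_inf_spec (op_sub P G) S W) as [W0 [WR [WS WV]]]; try easy; [apply SU|].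
    apply vl_le_trans with (W y); [apply WV; [apply HV|easy|easy]|].
    assert (K : G y <= G y - W y).
    { apply (Gsup y). intros d [W' [HW' ->]].
      assert (L : W' y + W y <= G y).
      { apply (Gub (fun z => W' z + W z)). assert (HW'' := HW').
        destruct HW' as [HWa [W0' [WP [S' [t [AS' [Ht WS']]]]]]].
        destruct HA as [_ Hdir]. destruct (Hdir S S' AS AS') as [S2 [AS2 [SS2 SS2']]].
        rewrite op_leP in SS2, SS2'.
        split; [|split; [|split]].
        - intros z z' Hz. rewrite HWa, HW by easy. vring.
        - intros z. rewrite <- (addr0 0). now apply le_add.
        - intros z. assert (L := le_add _ _ _ _ (Gub W' z HW'') (WR z)). vle L.
        (* The part [W'] uses [t] copies of [S2], and [W], which lies below [S], uses one more. *)
        - exists S2, (t + 1)%R. split; [easy|]. split; [lra|]. intros z.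
          assert (L1 : W' z <= t *: S2 z)
            by (apply vl_le_trans with (t *: S' z); [easy|now apply vl_le_scal]).
          assert (L2 : W z <= S2 z) by (apply vl_le_trans with (S z); easy).
          assert (L := le_add _ _ _ _ L1 L2). vle L. }
      vle L. }
    vle K. }
  intros Hc. apply vl_le_trans with (G x).
  (* [P - G] is disjoint from [A], hence from [P]; it also lies below [P], so it is at most zero. *)
  + destruct HP as [_ [[_ HPP] _]].
    assert (K : op_sub P G x <= 0).
    { apply (disj_U_le0 P (op_sub P G)); [now apply HPP|easy|easy|].
      intros y. apply vl_le_refl. }
    vle K.
  + apply (Gsup x). intros d [W [HW ->]]. auto.
Qed.

(** * The two inequalities for the complementary projection *)

Lemma piA_compl_le_sup (x : E) (eps : R) S s : (0 < eps)%R -> A S ->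
  (forall y rho, fragment x y -> band_proj rho -> rho (S y) <= eps *: S x ->
     rho (T y) <= s) ->
  op_sub T P x <= s.
Proof.
intros Heps AS Hs. set (Q := op_sub T P).
destruct (HAp S AS) as [SU S0]. assert (HSa := proj1 SU).
destruct inUp_piA_compl as [QU Q0]. fold Q in QU, Q0. assert (HQa := proj1 QU).
destruct inUp_piA as [_ P0].
assert (Sx0 : 0 <= eps *: S x).
{ assert (L : eps *: 0 <= eps *: S x) by (apply vl_le_scal; [lra|easy]). vle L. }
(* Split [Q x] as [Q (x - y) + Q y] and use [rho (Q y) <= rho (T y) <= s]. *)
assert (Hbound : forall y rho, fragment x y -> band_proj rho ->
  rho (S y) <= eps *: S x -> (Q x - s) ⊔ 0 <= Q (x - y) + (Q y - rho (Q y))).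
{ intros y rho Hy Hrho Hle. apply vl_sup_least.
  - assert (L : rho (Q y) <= rho (T y))
      by (apply band_proj_le; [easy|]; assert (L := P0 y); unfold Q; vle L).
    assert (K := vl_le_trans _ _ _ _ L (Hs y rho Hy Hrho Hle)).
    rewrite (orth_additive_fragment Q x y) by easy. vle K.
  - assert (L := band_proj_le_id rho Hrho _ (Q0 y)).
    assert (K := Q0 (x - y)).
    rewrite <- (addr0 0). apply le_add; [easy|vle L]. }
set (v := (Q x - s) ⊔ 0) in *.
assert (v0 : 0 <= v) by apply vl_sup_ubr.
assert (Hdisj : v ⟂ eps *: S x).
{ apply disj_posP; [easy|easy|]. intros m Hm Km.
  apply (disj_U_fragment_sums S Q x); try easy.
  - destruct HP as [_ [_ [_ H]]]. now apply H.
  - intros y Hy. set (w := S y - eps *: S x).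
    destruct (exists_disj_band_proj HF (w ⊔ 0)) as [rho [Hrho [Hfix Hw]]].
    assert (Hneg : rho ((- w) ⊔ 0) = (- w) ⊔ 0)
      by apply Hfix, disj_sym, pos_disj_neg.
    assert (Ew : w = (w ⊔ 0) - ((- w) ⊔ 0)) by (rewrite (pos_eq_add_neg w); vring).
    (* [rho] removes the positive part of [w] and keeps the negative one: [rho (S y)] falls below
       [rho (eps *: S x)], while the complementary parts compare the other way. *)
    assert (Erho : rho w = - ((- w) ⊔ 0)).
    { transitivity (rho ((w ⊔ 0) - ((- w) ⊔ 0))); [now rewrite <- Ew|].
      rewrite band_projB, Hw, Hneg by easy. vring. }
    assert (L : rho (S y) <= eps *: S x).
    { apply vl_le_trans with (rho (eps *: S x)); [|now apply band_proj_le_id].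
      assert (L : rho w <= 0) by (rewrite Erho; assert (L := pos_ge0 (- w)); vle L).
      unfold w in L. rewrite band_projB in L by easy. vle L. }
    assert (L2 : eps *: S x - rho (eps *: S x) <= S y - rho (S y)).
    { assert (L2 : 0 <= w - rho w)
        by (rewrite Erho; assert (L2 := pos_ge0 w); rewrite pos_eq_add_neg in L2; vle L2).
      unfold w in L2. rewrite band_projB in L2 by easy. vle L2. }
    (* The minorant [m] is cut by [rho]: off [rho] it is controlled by [m <= eps *: S x], on [rho]
       by [m <= v], since [rho] kills [Q y - rho (Q y)]. *)
    assert (L3 : m - rho m <= S y).
    { eapply vl_le_trans; [apply band_proj_compl_le; eassumption|].
      eapply vl_le_trans; [exact L2|].
      assert (K := band_proj_ge0 rho Hrho _ (S0 y)). vle K. }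
    assert (L4 : rho m <= Q (x - y)).
    { apply vl_le_trans with (rho (Q (x - y) + (Q y - rho (Q y)))).
      - apply band_proj_le; [easy|]. apply vl_le_trans with v; auto.
      - rewrite (band_projD rho Hrho), (band_projB rho Hrho), (band_projK rho Hrho).
        assert (K := band_proj_le_id rho Hrho _ (Q0 (x - y))). vle K. }
    assert (K := le_add _ _ _ _ L3 L4). vle K. }
(* This second projection fixes [v] and kills [S x], so it is admissible with the fragment [x].
   Applying it to [v <= Q x - rho (Q x)] yields [v <= 0]. *)
destruct (exists_disj_band_proj HF (eps *: S x)) as [rho [Hrho [Hfix Hw]]].
assert (HSx : rho (S x) = 0).
{ replace (S x) with ((/ eps)%R *: (eps *: S x)).
  - rewrite band_projZ, Hw by easy. apply scalr0.
  - rewrite vl_scalA, Rinv_l by lra. apply vl_scal1. }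
assert (K : v <= Q (x - x) + (Q x - rho (Q x))).
{ apply Hbound; [apply fragment_refl|easy|now rewrite HSx]. }
replace (x - x) with (0 : E) in K by vring.
rewrite (orth_additive0 Q), vl_add0 in K by easy.
assert (L : v <= 0).
{ rewrite <- (Hfix v Hdisj).
  apply vl_le_trans with (rho (Q x - rho (Q x))); [now apply band_proj_le|].
  rewrite band_projB, band_projK by easy.
  replace (rho (Q x) - rho (Q x)) with (0 : F) by vring. apply vl_le_refl. }
assert (M := vl_le_trans _ _ _ _ (vl_sup_ubl _ (Q x - s) 0) L). vle M.
Qed.

(** Write [T y = Q y + (P - W) y + W y]. The first two operators are positive, so under [rho] they
    are bounded by their values at [x]; the third is controlled by [W <= t S] and admissibility. *)
Lemma inf_sup_le_piA_compl (x : E) c :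
  (forall (eps : R) S s, (0 < eps)%R -> A S ->
     (forall y rho, fragment x y -> band_proj rho -> rho (S y) <= eps *: S x ->
        rho (T y) <= s) ->
     c <= s) ->
  c <= op_sub T P x.
Proof.
intros Hc. set (Q := op_sub T P).
destruct inUp_piA_compl as [QU Q0]. fold Q in QU, Q0. assert (HQa := proj1 QU).
destruct inUp_piA as [PU P0]. assert (HPa := proj1 PU).
(* Rearranged as an upper bound of [P x], so that it suffices to bound each dominated part [W x]. *)
enough (H : P x <= Q x + P x - c) by vle H.
apply piA_le_of_dominated_parts. intros W [HW [W0 [WP [S [t [AS [Ht WS]]]]]]].
enough (H : c <= Q x + P x - W x) by vle H.
destruct (HAp S AS) as [SU S0].
apply (archimedean_le HF _ _ (t *: S x)).
{ assert (L : t *: 0 <= t *: S x) by now apply vl_le_scal. vle L. }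
intros e He. apply (Hc e S); [easy|easy|]. intros y rho Hy Hrho Hle.
assert (L1 : rho (Q y) <= Q x).
{ apply vl_le_trans with (Q y); [now apply band_proj_le_id|now apply pos_fragment_le]. }
assert (L2 : rho (op_sub P W y) <= op_sub P W x).
{ assert (D0 : forall z, 0 <= op_sub P W z) by (intros z; assert (L := WP z); vle L).
  apply vl_le_trans with (op_sub P W y); [now apply band_proj_le_id|].
  apply pos_fragment_le; [|easy|easy].
  intros z z' Hz. unfold op_sub. rewrite HPa, HW by easy. vring. }
assert (L3 : rho (W y) <= t *: (e *: S x)).
{ apply vl_le_trans with (rho (t *: S y)); [now apply band_proj_le|].
  rewrite band_projZ by easy. now apply vl_le_scal. }
assert (L := le_add _ _ _ _ (le_add _ _ _ _ L1 L2) L3).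
replace (T y) with (Q y + op_sub P W y + W y) by (unfold Q; vring).
rewrite !(band_projD rho Hrho). unfold op_sub in L at 2. vle L.
Qed.
End Projection.
End Operators.

(* The two formulas for the band projections *)
Close Scope vl_scope.

Theorem theorem3p4 (E F : VectorLattice) (HF : dedekind_complete F)
  (A : (E -> F) -> Prop) (HAp : forall S, A S -> inUp S) (HA : increasing_set A)
  (T : E -> F) (HT : inUp T) (P : E -> F) (HP : is_piA A T P) (x : E) :
  is_sup
    (fun i : F => exists (eps : R) (S : E -> F), 0 < eps /\ A S /\
       is_inf
         (fun v : F => exists (y : E) (rho : F -> F),
            fragment x y /\ band_proj rho /\
            vl_le (rho (S (vl_sub x y))) (vl_scal eps (S x)) /\
            v = vl_add (rho (T y)) (vl_sub (T x) (rho (T x))))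
         i)
    (P x)
  /\
  is_inf
    (fun s : F => exists (eps : R) (S : E -> F), 0 < eps /\ A S /\
       is_sup
         (fun v : F => exists (y : E) (rho : F -> F),
            fragment x y /\ band_proj rho /\
            vl_le (rho (S y)) (vl_scal eps (S x)) /\
            v = rho (T y))
         s)
    (op_sub T P x).
Proof.
assert (HTa : orth_additive T) by apply HT.
assert (T0 : forall z, vl_le vl_zero (T z)) by apply HT.
set (supset := fun eps S (v : F) => exists (y : E) (rho : F -> F),
  fragment x y /\ band_proj rho /\ vl_le (rho (S y)) (vl_scal eps (S x)) /\ v = rho (T y)).
set (infset := fun eps S (v : F) => exists (y : E) (rho : F -> F),
  fragment x y /\ band_proj rho /\ vl_le (rho (S (vl_sub x y))) (vl_scal eps (S x)) /\
  v = vl_add (rho (T y)) (vl_sub (T x) (rho (T x)))).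
change (is_sup (fun i => exists eps S, 0 < eps /\ A S /\ is_inf (infset eps S) i) (P x) /\
  is_inf (fun s => exists eps S, 0 < eps /\ A S /\ is_sup (supset eps S) s) (op_sub T P x)).
(* The substitution [y := x - y] turns the first formula into the second one. *)
assert (Hswap : forall eps S v, infset eps S v <-> supset eps S (vl_sub (T x) v)).
{ intros eps S v. split; intros [y [rho [Hy [Hrho [Hle Hv]]]]];
    exists (vl_sub x y), rho; (split; [now apply fragment_compl|]); (split; [easy|]).
  - split; [easy|]. rewrite Hv, (orth_additive_fragment T x y), (band_projD rho Hrho) by easy. vring.
  - replace (vl_sub x (vl_sub x y)) with y by vring. split; [easy|].
    replace v with (vl_sub (T x) (vl_sub (T x) v)) by vring.
    rewrite Hv, (orth_additive_fragment T x y), (band_projD rho Hrho) by easy. vring. }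
(* The map [v |-> T x - v] reverses the order, hence exchanges infima and suprema. *)
assert (Hinfsup : forall eps S i, is_inf (infset eps S) i <->
                                 is_sup (supset eps S) (vl_sub (T x) i)).
{ intros eps S i. split; intros [Hb Hg]; split.
  - intros d Hd. assert (L : vl_le i (vl_sub (T x) d)).
    { apply Hb, Hswap. now replace (vl_sub (T x) (vl_sub (T x) d)) with d by vring. }
    vle L.
  - intros b Hub. assert (L : vl_le (vl_sub (T x) b) i).
    { apply Hg. intros d Hd. apply Hswap in Hd. assert (L := Hub _ Hd). vle L. }
    vle L.
  - intros d Hd. apply Hswap in Hd. assert (L := Hb _ Hd). vle L.
  - intros b Hlb. assert (L : vl_le (vl_sub (T x) i) (vl_sub (T x) b)).
    { apply Hg. intros d Hd. assert (L : vl_le b (vl_sub (T x) d)).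
      { apply Hlb, Hswap. now replace (vl_sub (T x) (vl_sub (T x) d)) with d by vring. }
      vle L. }
    vle L. }
(* The outer infimum ranges over suprema that exist, so a lower bound of that family says something
   about a pair [eps], [S] only through this existence. The fragment [0] is always admissible, and
   [T x] is an upper bound. *)
assert (Hex : forall eps S, 0 < eps -> A S -> exists s, is_sup (supset eps S) s).
{ intros eps S Heps AS. destruct (HAp S AS) as [[HSa _] S0]. apply HF.
  - destruct (exists_disj_band_proj HF vl_zero) as [rho [Hrho _]].
    exists (rho (T vl_zero)), vl_zero, rho. split; [apply fragment0|]. split; [easy|].
    split; [|easy]. apply vl_le_trans with (S vl_zero); [now apply band_proj_le_id|].
    rewrite orth_additive0 by easy.
    rewrite <- (scalr0 eps). apply vl_le_scal; [now apply Rlt_le|easy].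
  - exists (T x). intros d [y [rho [Hy [Hrho [_ ->]]]]].
    apply vl_le_trans with (T y); [now apply band_proj_le_id|now apply pos_fragment_le]. }
assert (Hsecond : is_inf (fun s => exists eps S, 0 < eps /\ A S /\ is_sup (supset eps S) s)
                         (op_sub T P x)).
{ split.
  - intros s [eps [S [Heps [AS [Hub _]]]]].
    apply (piA_compl_le_sup HF A HAp T P HT HP x eps S); [easy|easy|].
    intros y rho Hy Hrho Hle. apply Hub. now exists y, rho.
  - intros c Hc. apply (inf_sup_le_piA_compl HF A HAp HA T P HT HP).
    intros eps S s Heps AS Hs. destruct (Hex eps S Heps AS) as [s' Hs'].
    apply vl_le_trans with s'; [apply Hc; now exists eps, S|].
    apply Hs'. intros d [y [rho [Hy [Hrho [Hle ->]]]]]. now apply Hs. }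
split; [|easy]. destruct Hsecond as [Hlb Hglb]. split.
- intros i [eps [S [Heps [AS Hi]]]]. apply Hinfsup in Hi.
  assert (L : vl_le (op_sub T P x) (vl_sub (T x) i)) by (apply Hlb; now exists eps, S).
  vle L.
- intros b Hb. assert (L : vl_le (vl_sub (T x) b) (op_sub T P x)).
  { apply Hglb. intros s [eps [S [Heps [AS Hs]]]].
    assert (L : vl_le (vl_sub (T x) s) b).
    { apply Hb. exists eps, S. split; [easy|]. split; [easy|]. apply Hinfsup.
      now replace (vl_sub (T x) (vl_sub (T x) s)) with s by vring. }
    vle L. }
  vle L.
Qed.
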